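(* For $a\in(0,1)$ define $$g^{(a)}(n)=\begin{cases}\sqrt{n\log n}, & a\le\tfrac12,\\ n^a, & a>\tfrac12.\end{cases}$$ Let $x>0$. For every finite alphabet $\mathcal{A}$ with $|\mathcal{A}|\ge2$ there exists a constant $C_1(x,|\mathcal{A}|)$, depending only on $x$ and $|\mathcal{A}|$, such that for every $a\in(0,1)$ $$\varlimsup_{n\to\infty}\frac{R^{(\mathrm{al})}_{\lfloor|\mathcal{A}|n-xn^a\rfloor,n}}{(g^{(a)}(n))^{2/3}}\le C_1(x,|\mathcal{A}|)\qquad\mathbb{P}\text{-a.s.},$$ and these constants satisfy $C_1(x,|\mathcal{A}|)\to0$ as $|\mathcal{A}|\to\infty$.
   Context: Alignment model: $\eta^{\mathrm{x}}=\eta^{\mathrm{x}}_1\eta^{\mathrm{x}}_2\cdots$ and $\eta^{\mathrm{y}}=\eta^{\mathrm{y}}_1\eta^{\mathrm{y}}_2\cdots$ are two independent infinite words whose letters are chosen independently and uniformly at random from $\mathcal{A}$; their joint law is $\mathbb{P}$. The environment is $\omega_{i,j}=1$ if $\eta^{\mathrm{x}}_i=\eta^{\mathrm{y}}_j$ and $\omega_{i,j}=0$ otherwise ($i,j\ge1$). An admissible path from $(0,0)$ to $(m,n)$ is a lattice path whose increments all lie in $\{e_1,e_2,e_1+e_2\}$. For an admissible path $\pi$, a match is a step $e_1+e_2$ whose endpoint $(i,j)$ has $\omega_{i,j}=1$, a mismatch is a step $e_1+e_2$ whose endpoint has $\omega_{i,j}=0$, and a gap is a step $e_1$ or $e_2$.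 Let $x(\pi),y(\pi),z(\pi)$ be the numbers of mismatches, gaps and matches of $\pi$. Optimality regions (with mismatch penalty $\alpha=0$): for a gap penalty $\beta\ge 0$ the score of $\pi$ is $z(\pi)-\beta y(\pi)$. Let $\Gamma^{(\beta)}_{0,(m,n)}$ be the set of minimal-gap maximisers, i.e. the paths from $(0,0)$ to $(m,n)$ that maximise the score and, among the maximisers, have the smallest number of gaps. Two penalties $\beta,\beta'$ lie in different optimality regions iff $\Gamma^{(\beta)}_{0,(m,n)}\cap\Gamma^{(\beta')}_{0,(m,n)}=\varnothing$. The critical penalties $0<\beta_1<\dots<\beta_{R}<\infty$ are the values of $\beta>0$ at which the optimality region changes as $\beta$ increases, and $R=R^{(\mathrm{al})}_{m,n}$ is the number of these critical penalties. *)

(* Defs.v *)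
From HB Require Import structures.
From mathcomp Require Import all_boot all_order all_algebra.
From mathcomp Require Import finmap.
From mathcomp Require Import all_classical all_reals all_analysis.
Set Implicit Arguments.
Unset Strict Implicit.
Unset Printing Implicit Defensive.
Import Order.TTheory GRing.Theory Num.Theory.
Import numFieldNormedType.Exports.
Local Open Scope classical_set_scope.
Local Open Scope ring_scope.

(* A lattice path started at (0,0) is the sequence of the points it visits
   after (0,0), so that it is determined by its increments. *)
Definition lattice_path := seq (nat * nat).

Definition admissible_step (u v : nat * nat) : bool :=
  [|| v == (u.1.+1, u.2), v == (u.1, u.2.+1) | v == (u.1.+1, u.2.+1)].

Definition admissible_path (m n : nat) (p : lattice_path) : bool :=
  path admissible_step (0, 0)%N p && (last (0, 0)%N p == (m, n)).

(* The (initial point, endpoint) pairs of the successive steps. *)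
Definition steps (p : lattice_path) : seq ((nat * nat) * (nat * nat)) :=
  zip ((0, 0)%N :: p) p.

Definition diagonal (s : (nat * nat) * (nat * nat)) : bool :=
  s.2 == (s.1.1.+1, s.1.2.+1).

(* Words are indexed from 0: their i-th letter, i >= 1, is at index i - 1. *)
Definition environment (A : eqType) (wx wy : nat -> A) (i j : nat) : bool :=
  wx i.-1 == wy j.-1.

Definition matches (omega : nat -> nat -> bool) (p : lattice_path) : nat :=
  count (fun s => diagonal s && omega s.2.1 s.2.2) (steps p).

Definition gaps (p : lattice_path) : nat :=
  count (fun s => ~~ diagonal s) (steps p).

Section Regions.
Variables (R : realType) (omega : nat -> nat -> bool) (m n : nat).

Definition score (beta : R) (p : lattice_path) : R :=
  (matches omega p)%:R - beta * (gaps p)%:R.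

Definition maximisers (beta : R) : set lattice_path :=
  [set p | admissible_path m n p /\
    forall q, admissible_path m n q -> score beta q <= score beta p].

Definition min_gap_maximisers (beta : R) : set lattice_path :=
  [set p | maximisers beta p /\
    forall q, maximisers beta q -> (gaps p <= gaps q)%N].

Definition different_regions (beta beta' : R) : Prop :=
  min_gap_maximisers beta `&` min_gap_maximisers beta' = set0.

(* The region changes at beta: penalties arbitrarily close to beta, on either
   side of it (beta included), lie in different regions. *)
Definition critical_penalties : set R :=
  [set beta | 0 < beta /\ forall e : R, 0 < e ->
    exists b b' : R, [/\ 0 <= b, beta - e < b <= beta, beta <= b' < beta + e &
      different_regions b b']].

(* [counting] is +oo on infinite sets, so that finiteness is not presupposed. *)
Definition num_critical_penalties : \bar R := counting critical_penalties.

End Regions.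

Section Words.
Context {d : measure_display} {Omega : measurableType d} {R : realType}.
Variables (P : probability Omega R) (A : finType).

(* [X] is a family of mutually independent random variables with values in
   the discrete space [A]. *)
Definition mutually_independent (I : choiceType) (X : I -> Omega -> A) : Prop :=
  (forall i (B : set A), measurable (X i @^-1` B)) /\
  forall (J : {fset I}) (B : I -> set A),
    P (\bigcap_(i in [set` J]) (X i @^-1` B i)) =
    (\prod_(i <- J) P (X i @^-1` B i))%E.

Definition uniformly_distributed (X : Omega -> A) : Prop :=
  forall c : A, P (X @^-1` [set c]) = (#|A|%:R^-1)%:E.

(* All the letters of both words are independent and uniform. *)
Definition iid_uniform_words (etax etay : nat -> Omega -> A) : Prop :=
  let letter (k : nat + nat) :=
    match k with inl i => etax i | inr j => etay j end in
  mutually_independent letter /\ forall k, uniformly_distributed (letter k).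

End Words.

Definition g_fun (R : realType) (a : R) (n : nat) : R :=
  if a <= 2^-1 then Num.sqrt (n%:R * ln n%:R) else n%:R `^ a.

(* [Num.truncn] is the floor on nonnegative reals and 0 on negative ones; its
   argument here is nonnegative for all large n when x > 0, a < 1, k >= 2. *)
Definition first_length (R : realType) (x a : R) (k n : nat) : nat :=
  Num.truncn (k%:R * n%:R - x * n%:R `^ a).

(* Main.v *)
Require Import Defs.
From HB Require Import structures.
From mathcomp Require Import all_boot all_order all_algebra.
From mathcomp Require Import finmap.
From mathcomp Require Import all_classical all_reals all_analysis.
From mathcomp Require Import zify lra ring.
Set Implicit Arguments.
Unset Strict Implicit.
Unset Printing Implicit Defensive.
Import Order.TTheory GRing.Theory Num.Theory.
Import numFieldNormedType.Exports.
Local Open Scope classical_set_scope.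
Local Open Scope ring_scope.

(** Let [k] be the size of the alphabet and [m = floor (k n - x n^a)].

    Every admissible path to [(m, n)] with [n <= m] has at least [m - n] gaps
    and at most [n] matches.  Suppose that some path has exactly [m - n] gaps
    and at least [n - D] matches.  At any penalty [b >= 0] a maximiser then has
    at least [n - D] matches, and hence at most [m - n + 2 D] gaps.  At a
    critical penalty [b] two maximisers [p] and [q] with different numbers of
    gaps tie ([critical_tie]), so that [b] is the slope of the segment which
    joins the points (gaps, matches) of [p] and [q].  As [b] increases the
    number of gaps of a maximiser and its number of matches both decrease
    ([maximisers_antitone]); the segments of different critical penalties are
    therefore stacked without overlap inside a box of side [O(D)].  Their slopes
    are distinct and they have integer coordinates: at most [K^2] of them have
    size at most [K], and at most [2 D / K] are longer.  With [K] of order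
    [D^(1/3)] this leaves [O(D^(2/3))] critical penalties ([critical_count]).

    A path of this kind comes from the greedy alignment, which reads the long
    word letter by letter and matches a letter with the first letter of the
    short word that is still free, whenever the two agree.  If the greedy
    alignment of the first [m - D] letters makes [n - D] matches, then the last
    [D] letters of the short word can be placed on the diagonal
    ([greedy_path]).  Whatever the short word is, each letter of the long word
    is matched with probability [1/k] independently of the past, so that
    [i / k] minus the number of matches among the first [i] letters is a centred
    random walk.  An exponential maximal inequality, proved by induction on the
    number of letters ([maximal_inequality]), and the Borel-Cantelli lemma along
    the powers of two show that almost surely this walk is eventually below
    [c * sqrt (n ln n)], however small [c > 0] is ([greedy_lower]).  Working on
    dyadic blocks is what permits an arbitrarily small [c]: the block of index
    [j] is bad with probability at most [exp (- c' j)], which is summable for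
    every [c' > 0].

    The greedy alignment of [m - D] letters thus makes about
    [n - x n^a / k - D / k - o(g n)] matches, which exceeds [n - D] for
    [D = floor (4 x g(n) / k)] and [n] large.  Hence the theorem holds with
    [C1 k = 6 (4 x / k)^(2/3)], which tends to [0]. *)

(** * Admissible paths and the greedy alignment *)

Lemma steps_rcons (p : lattice_path) (v : nat * nat) :
  steps (rcons p v) = rcons (steps p) (last (0, 0)%N p, v).
Proof.
rewrite /steps -rcons_cons.
elim: p (0, 0)%N => [|u p IH] u0 //=.
by congr (_ :: _); rewrite -rcons_cons IH.
Qed.

Definition diagonals (p : lattice_path) : nat := count Defs.diagonal (steps p).

(** A diagonal step increases the sum of the coordinates by two, a gap by one. *)
Lemma gaps_diagonals (m n : nat) (p : lattice_path) :
  admissible_path m n p -> (gaps p + (diagonals p).*2 = m + n)%N.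
Proof.
elim/last_ind: p m n => [|p v IH] m n.
  by rewrite /admissible_path /= => /eqP[<- <-].
rewrite /admissible_path rcons_path last_rcons => /andP[/andP[pp st] /eqP vE].
have {IH} := IH (last (0, 0)%N p).1 (last (0, 0)%N p).2.
rewrite /admissible_path pp -surjective_pairing eqxx => /(_ isT).
rewrite /gaps /diagonals steps_rcons -!cats1 !count_cat /= /Defs.diagonal /=.
move: st; rewrite {}vE; case: (last _ p) => a b /=.
by rewrite /admissible_step /= !xpair_eqE; lia.
Qed.

Lemma diagonals_le (m n : nat) (p : lattice_path) :
  admissible_path m n p -> (diagonals p <= n)%N.
Proof.
elim/last_ind: p m n => [|p v IH] m n.
  by rewrite /admissible_path /= => /eqP[_ <-].
rewrite /admissible_path rcons_path last_rcons => /andP[/andP[pp st] /eqP vE].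
have {IH} := IH (last (0, 0)%N p).1 (last (0, 0)%N p).2.
rewrite /admissible_path pp -surjective_pairing eqxx => /(_ isT).
rewrite /diagonals steps_rcons -!cats1 !count_cat /= /Defs.diagonal /=.
move: st; rewrite {}vE; case: (last _ p) => a b /=.
by rewrite /admissible_step /= !xpair_eqE; lia.
Qed.

Lemma matches_le_diagonals omega (p : lattice_path) :
  (matches omega p <= diagonals p)%N.
Proof. by apply: sub_count => s /andP[]. Qed.

Definition reachable omega (i j y z : nat) : Prop :=
  exists p, [/\ admissible_path i j p, gaps p = y & matches omega p = z].

Lemma reachable0 omega : reachable omega 0 0 0 0.
Proof. by exists [::]. Qed.

Lemma reachable_step omega (i j y z : nat) (v : nat * nat) :
  reachable omega i j y z -> admissible_step (i, j) v ->
  reachable omega v.1 v.2 (y + ~~ Defs.diagonal ((i, j), v))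
    (z + (Defs.diagonal ((i, j), v) && omega v.1 v.2)).
Proof.
move=> [p [/andP[pp /eqP lp] <- <-]] st; exists (rcons p v); split.
- by rewrite /admissible_path rcons_path pp lp st last_rcons -surjective_pairing /=.
- by rewrite /gaps steps_rcons -cats1 count_cat lp /= addn0.
- by rewrite /matches steps_rcons -cats1 count_cat lp /= addn0.
Qed.

Lemma reachable_gap omega (i j y z : nat) :
  reachable omega i j y z -> reachable omega i.+1 j y.+1 z.
Proof.
move=> /(@reachable_step _ _ _ _ _ (i.+1, j)).
have nd : Defs.diagonal ((i, j), (i.+1, j)) = false.
  by rewrite /Defs.diagonal /= xpair_eqE; lia.
by rewrite /admissible_step eqxx nd /= addn1 addn0; apply.
Qed.

Lemma reachable_diagonal omega (i j y z : nat) :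
  reachable omega i j y z ->
  reachable omega i.+1 j.+1 y (z + omega i.+1 j.+1).
Proof.
move=> /(@reachable_step _ _ _ _ _ (i.+1, j.+1)).
by rewrite /admissible_step /Defs.diagonal /= eqxx !orbT addn0; apply.
Qed.

(** The number of matches made so far doubles as the index of the first letter of
    [wy] that is still free. *)
Fixpoint greedy {A : eqType} (wx wy : nat -> A) (i : nat) : nat :=
  if i is i'.+1 then
    (greedy wx wy i' + (wx i' == wy (greedy wx wy i')))%N
  else 0%N.

Lemma greedy_le (A : eqType) (wx wy : nat -> A) (i : nat) :
  (greedy wx wy i <= i)%N.
Proof. by elim: i => //= i IH; case: (_ == _); lia. Qed.

Lemma reachable_greedy (A : eqType) (wx wy : nat -> A) (i : nat) :
  reachable (environment wx wy) i (greedy wx wy i)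
    (i - greedy wx wy i) (greedy wx wy i).
Proof.
elim: i => [|i IH] /=; first exact: reachable0.
have le := greedy_le wx wy i.
have [e|ne] := boolP (wx i == wy (greedy wx wy i)).
  have := reachable_diagonal IH.
  rewrite (_ : environment _ _ _ _ = true) ?addn1 ?subSS //; exact: e.
by have := reachable_gap IH; rewrite addn0 subSn.
Qed.

(** The number of greedy matches grows by at most one per letter, so that it
    takes every intermediate value. *)
Lemma greedy_hits (A : eqType) (wx wy : nat -> A) (N t : nat) :
  (t <= greedy wx wy N)%N ->
  exists2 i, (i <= N)%N & greedy wx wy i = t.
Proof.
elim: N => [|N IH] /=; first by rewrite leqn0 => /eqP->; exists 0%N.
have [tle _|tgt tle] := leqP t (greedy wx wy N).
  by have [i iN <-] := IH tle; exists i => //; apply: leqW.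
exists N.+1 => //=; apply/eqP; rewrite eqn_leq tle andbT.
by case: (_ == _) tle tgt; lia.
Qed.

(** Follow the greedy path until its height is [n - D], which happens within the
    first [m - D] letters; go up along the diagonal, where a mismatch does
    no harm, and finish with horizontal gaps.  All [n] letters of the short word
    lie on diagonal steps, which makes the number of gaps minimal. *)
Lemma greedy_path (A : eqType) (wx wy : nat -> A) (m n D : nat) :
  (D <= n)%N -> (D <= m)%N -> (n - D <= greedy wx wy (m - D))%N ->
  exists p, [/\ admissible_path m n p, gaps p = (m - n)%N &
    (n - D <= matches (environment wx wy) p)%N].
Proof.
move=> Dn Dm /greedy_hits[i im gi].
have := reachable_greedy wx wy i; rewrite gi => reach0.
have ni : (n - D <= i)%N by rewrite -gi greedy_le.
have diags d : exists2 z, (n - D <= z)%N &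
    reachable (environment wx wy) (i + d) (n - D + d) (i - (n - D)) z.
  elim: d => [|d [z zge reach]]; first by exists (n - D)%N; rewrite ?addn0.
  eexists; last by rewrite !addnS; apply: reachable_diagonal reach.
  by rewrite (leq_trans zge) ?leq_addr.
have [z zge reach] := diags D.
have gapss g : reachable (environment wx wy) (i + D + g) (n - D + D)
    (i - (n - D) + g) z.
  elim: g => [|g IH]; first by rewrite !addn0.
  by rewrite !addnS; apply: reachable_gap.
have [p [pp gp mp]] := gapss (m - D - i)%N.
exists p; split.
- by move: pp; congr admissible_path; lia.
- by rewrite gp; lia.
- by rewrite mp.
Qed.

(** * Maximisers and critical penalties *)

(** Adding the two optimality inequalities gives
    [(b' - b) * (gaps p - gaps p') >= 0]; the optimality of [p] at [b] then
    turns the order of the gaps into the order of the matches. *)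
Lemma maximisers_antitone (R : realType) omega (m n : nat) (b b' : R) p p' :
  0 <= b < b' ->
  maximisers omega m n b p -> maximisers omega m n b' p' ->
  (gaps p' <= gaps p)%N /\ (matches omega p' <= matches omega p)%N.
Proof.
rewrite /maximisers /score => /andP[b0 bb'] [pp mp] [pp' mp'].
have := mp _ pp'; have := mp' _ pp => h1 h2.
have gg : (gaps p')%:R <= (gaps p)%:R :> R.
  rewrite leNgt; apply/negP => lt.
  have : (b' - b) * ((gaps p')%:R - (gaps p)%:R) > 0.
    by rewrite mulr_gt0 ?subr_gt0.
  by lra.
split; first by rewrite -(ler_nat R).
rewrite -(ler_nat R).
have : b * ((gaps p)%:R - (gaps p')%:R) >= 0.
  by rewrite mulr_ge0 ?subr_ge0.
by lra.
Qed.

(** The set [S] may be infinite, but the score depends only on the pair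
    (gaps, matches), which ranges over a finite set. *)
Lemma score_argmax (R : realType) omega (b : R) (S : set lattice_path) (B : nat) :
  S !=set0 ->
  (forall p, S p -> (gaps p < B.+1)%N /\ (matches omega p < B.+1)%N) ->
  exists2 p, S p & forall q, S q -> score omega b q <= score omega b p.
Proof.
move=> [p0 Sp0] SB.
pose attained (t : 'I_B.+1 * 'I_B.+1) :=
  `[< exists2 p, S p & gaps p = t.1 /\ matches omega p = t.2 >].
have att p (Sp : S p) :
    attained (Ordinal (SB p Sp).1, Ordinal (SB p Sp).2) by apply/asboolP; exists p.
case: (@Order.TotalTheory.arg_maxP _ _ _ _ attained
  (fun t => (t.2 : nat)%:R - b * (t.1 : nat)%:R) (att _ Sp0)).
move=> t /asboolP[p Sp [gp mp]] tmax; exists p => // q Sq.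
by have := tmax _ (att _ Sq); rewrite /score /= gp mp.
Qed.

Lemma path_bounds (m n : nat) omega p : admissible_path m n p ->
  (gaps p < (m + n).+1)%N /\ (matches omega p < (m + n).+1)%N.
Proof.
move=> pp; have := gaps_diagonals pp; have := diagonals_le pp.
by have := matches_le_diagonals omega p; lia.
Qed.

(** If all maximisers at [b] had as many gaps as one of them, [p], then the
    paths with another number of gaps would lose to [p] at [b] by a margin that
    is bounded below, since only finitely many scores occur.  By continuity
    they would still lose at all penalties near [b], where [p] would
    consequently remain a minimal-gap maximiser: all these penalties would lie
    in one region. *)
Lemma critical_tie (R : realType) omega (m n : nat) (b : R) p0 :
  admissible_path m n p0 -> critical_penalties omega m n b ->
  exists p q, [/\ maximisers omega m n b p, maximisers omega m n b q &
    (gaps p < gaps q)%N].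
Proof.
move=> pp0 [b0 crit]; apply: contrapT => notie.
have [||p pp pmax] := @score_argmax R omega b (admissible_path m n) (m + n).
- by exists p0.
- by move=> p; apply: path_bounds.
have mp : maximisers omega m n b p by split.
have tie q : maximisers omega m n b q -> gaps q = gaps p.
  move=> mq; case: (ltngtP (gaps q) (gaps p)) => // lt; case: notie.
  - by exists q, p; split; [exact: mq|exact: mp|exact: lt].
  - by exists p, q; split; [exact: mp|exact: mq|exact: lt].
pose other := [set q | admissible_path m n q /\ gaps q <> gaps p].
(* The margin of [p], divided by a bound on the differences of gaps. *)
have [e e0 He] : exists2 e : R, 0 < e & forall b', `|b' - b| < e ->
    forall q, other q -> score omega b' q < score omega b' p.
  have [ne|emp] := pselect (other !=set0); last first.
    by exists 1 => // b' _ q oq; case: emp; exists q.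
  have [|r [rp rg] rmax] := @score_argmax R omega b other (m + n) ne.
    by move=> q [qp _]; apply: path_bounds.
  have gt : score omega b r < score omega b p.
    rewrite lt_neqAle pmax // andbT; apply/eqP => er; apply: rg; apply: tie.
    by split => // q qp; rewrite er; apply: pmax.
  have mn0 : 0 < (m + n).+1%:R :> R by rewrite ltr0n.
  exists ((score omega b p - score omega b r) / (m + n).+1%:R).
    by rewrite divr_gt0 // subr_gt0.
  move=> b'; rewrite ltr_pdivlMr // => bb' q oq.
  have qr := rmax _ oq; case: oq => qp _.
  have gd : `|(gaps q)%:R - (gaps p)%:R| <= (m + n).+1%:R :> R.
    have [gq _] := path_bounds omega qp; have [gp _] := path_bounds omega pp.
    move: gq gp; rewrite -!(ltr_nat R) ler_norml => gq gp.
    have := ler0n R (gaps q); have := ler0n R (gaps p); by lra.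
  have : `|(b' - b) * ((gaps q)%:R - (gaps p)%:R)| < score omega b p - score omega b r.
    rewrite normrM; apply: le_lt_trans bb'; exact: ler_wpM2l.
  rewrite ltr_norml => /andP[+ _]; move: qr; rewrite /score; lra.
have inG b' : `|b' - b| < e -> min_gap_maximisers omega m n b' p.
  move=> be; have same q : admissible_path m n q -> gaps q = gaps p ->
      score omega b' q <= score omega b' p.
    by move=> qp gq; have := pmax _ qp; rewrite /score gq; lra.
  split; first split => // q qp.
    have [gq|/eqP gq] := eqVneq (gaps q) (gaps p); first exact: same.
    by apply/ltW/(He _ be).
  move=> q [qp qmax]; have [->//|/eqP gq] := eqVneq (gaps q) (gaps p).
  by have := qmax _ pp; rewrite leNgt He.
have [b1 [b2 [b1p /andP[b1l b1u] /andP[b2l b2u] dif]]] := crit e e0.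
suff : (min_gap_maximisers omega m n b1 `&` min_gap_maximisers omega m n b2) p.
  by rewrite dif.
by split; apply: inG; rewrite ltr_norml; lra.
Qed.

(** The penalties increase while their intervals go down: the intervals of the
    penalties after the first one, [b], fit below [l b]. *)
Lemma disjoint_intervals (R : realType) (s : seq R) (l u : R -> nat) (L U : nat) :
  sorted <%R s ->
  (forall b, b \in s -> (L <= l b <= u b)%N /\ (u b <= U)%N) ->
  (forall b b', b \in s -> b' \in s -> b < b' -> (u b' <= l b)%N) ->
  (\sum_(b <- s) (u b - l b) <= U - L)%N.
Proof.
elim: s U => [|b s IH] U; first by rewrite big_nil.
move=> /[dup] /order_path_min ords /path_sorted srt bnd sep.
rewrite big_cons.
have /andP[Ll lu] := (bnd b (mem_head _ _)).1; have uU := (bnd b (mem_head _ _)).2.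
suff : (\sum_(b0 <- s) (u b0 - l b0) <= l b - L)%N by lia.
apply: IH => // [b' b's|b' b'' b's b''s].
  split; first by apply: (bnd b' _).1; rewrite inE b's orbT.
  apply: sep; rewrite ?mem_head ?inE ?b's ?orbT //.
  exact: (allP (ords lt_trans)).
by apply: sep; rewrite inE ?b's ?b''s orbT.
Qed.

(** A slope [b] is determined by its integer vector [(y b, z b)]: there are at
    most [K * K] positive vectors of size at most [K], and each of the others
    uses up [K] of the total size [W]. *)
Lemma few_slopes (R : realType) (s : seq R) (y z : R -> nat) (K W : nat) :
  uniq s ->
  (forall b, b \in s -> [/\ 0 < b, (0 < y b)%N & (z b)%:R = b * (y b)%:R]) ->
  (\sum_(b <- s) (y b + z b) <= W)%N ->
  (size s * K <= K ^ 3 + W)%N.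
Proof.
move=> us slope sumW.
pose small b := (y b + z b <= K)%N.
have /eqP := count_predC small s.
have zpos b : b \in s -> (0 < z b)%N.
  move=> /slope[b0 y0 zE]; rewrite -(ltr0n R) zE mulr_gt0 //.
  by rewrite ltr0n.
(* Both coordinates are positive, hence smaller than [K]. *)
have nsmall : (count small s <= K * K)%N.
  rewrite -size_filter -(size_map (fun b => (y b, z b))).
  have -> : (K * K)%N = size [seq (i, j) | i <- iota 0 K, j <- iota 0 K].
    by rewrite size_allpairs size_iota.
  apply: uniq_leq_size.
    rewrite map_inj_in_uniq ?filter_uniq // => b b'.
    rewrite !mem_filter => /andP[_ bs] /andP[_ b's] [yy zz].
    have [_ y0 zE] := slope _ bs; have [_ _ zE'] := slope _ b's.
    apply: (@mulIf _ (y b)%:R); first by rewrite pnatr_eq0 -lt0n.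
    by rewrite -zE yy -zE' zz.
  move=> t /mapP[b]; rewrite mem_filter => /andP[sb bs] ->.
  apply: allpairs_f; rewrite mem_iota /=.
    by have := zpos _ bs; move: sb; rewrite /small; lia.
  by have [_ + _] := slope _ bs; move: sb; rewrite /small; lia.
have nlarge : (count (predC small) s * K <= W)%N.
  apply: leq_trans sumW; elim: (s) => [|b s' IH]; first by rewrite big_nil.
  rewrite big_cons /= mulnDl leq_add // /small -ltnNge.
  by case: ltnP => [/ltnW|]; rewrite ?mul1n.
move=> /eqP <-; rewrite mulnDl leq_add //.
by rewrite !expnS expn0 muln1 mulnA leq_mul2r nsmall orbT.
Qed.

Lemma counting_le (T : choiceType) (R : realType) (S : set T) (B : R) :
  (forall s : seq T, uniq s -> {subset s <= S} -> (size s)%:R <= B) ->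
  (@counting T R S <= B%:E)%E.
Proof.
move=> SB; have [fin|inf] := pselect (finite_set S); last first.
  have [C CS Csz] := infinite_set_fset (Num.truncn B).+1 inf.
  have : (size (enum_fset C))%:R <= B.
    apply: SB; first exact: fset_uniq.
    by move=> t tC; rewrite inE; apply: CS.
  rewrite leNgt; case/negP; apply: lt_le_trans (truncnS_gt _) _.
  by rewrite ler_nat.
rewrite /counting asboolT // lee_fin; apply: SB; first exact: fset_uniq.
by move=> t; rewrite in_fset_set.

Qed.

(** The score at [b >= 0] of a path with the fewest possible gaps bounds from
    below the number of matches of a maximiser.  Its number of diagonal steps
    is then at least [n - D], which bounds its gaps. *)
Lemma maximiser_bounds (R : realType) omega (m n D : nat) (b : R) p0 p :
  admissible_path m n p0 -> gaps p0 = (m - n)%N ->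
  (n - D <= matches omega p0)%N -> (n <= m)%N -> 0 <= b ->
  maximisers omega m n b p -> (m - D <= gaps p + matches omega p <= m + D)%N.
Proof.
move=> pp0 g0 m0 nm b0 [pp /(_ _ pp0)]; rewrite /score => sc.
have gle : (gaps p0 <= gaps p)%N.
  by rewrite g0; have := gaps_diagonals pp; have := diagonals_le pp; lia.
have mle : (matches omega p0 <= matches omega p)%N.
  rewrite -(ler_nat R); move: gle; rewrite -(ler_nat R) => gle.
  have : b * ((gaps p)%:R - (gaps p0)%:R) >= 0 by rewrite mulr_ge0 ?subr_ge0.
  by lra.
have := gaps_diagonals pp; have := diagonals_le pp.
have := matches_le_diagonals omega p; move: gle mle; rewrite g0; lia.
Qed.

(** The segment of a critical penalty is measured by the increase of
    gaps + matches along it.  These increases are the lengths of stacked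
    intervals inside [[m - D, m + D]]. *)
Lemma critical_count (R : realType) omega (m n D : nat) (T : R) p0 :
  admissible_path m n p0 -> gaps p0 = (m - n)%N ->
  (n - D <= matches omega p0)%N -> (n <= m)%N -> 1 <= T -> D%:R <= T ->
  (num_critical_penalties R omega m n <= (6 * T `^ (2 / 3))%:E)%E.
Proof.
move=> pp0 g0 m0 nm T1 DT; apply: counting_le => s us sC.
have /choice[f fP] (b : R) : exists pq : lattice_path * lattice_path,
    critical_penalties omega m n b ->
    [/\ maximisers omega m n b pq.1, maximisers omega m n b pq.2 &
      (gaps pq.1 < gaps pq.2)%N].
  have [cb|ncb] := pselect (critical_penalties omega m n b).
    by have [p [q H]] := critical_tie pp0 cb; exists (p, q) => _; exact: H.
  by exists ([::], [::]) => cb; case: ncb.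
have sP b : b \in s -> [/\ 0 < b, maximisers omega m n b (f b).1,
    maximisers omega m n b (f b).2 & (gaps (f b).1 < gaps (f b).2)%N].
  by move=> /sC; rewrite inE => cb; have [] := fP b cb; case: cb.
pose s' := sort <=%R s.
have srt : sorted <%R s' by rewrite sort_lt_sorted.
have s's b : (b \in s') = (b \in s) by rewrite mem_sort.
have us' : uniq s' by rewrite sort_uniq.
rewrite -(size_sort <=%R s) -/s'.
have rise b : b \in s ->
    (matches omega (f b).2)%:R - (matches omega (f b).1)%:R
      = b * ((gaps (f b).2)%:R - (gaps (f b).1)%:R) /\
    (matches omega (f b).1 <= matches omega (f b).2)%N.
  move=> /sP[b0 [a1 M1] [a2 M2] lt].
  have := M1 _ a2; have := M2 _ a1; rewrite /score => h1 h2.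
  have e : (matches omega (f b).2)%:R - (matches omega (f b).1)%:R
      = b * ((gaps (f b).2)%:R - (gaps (f b).1)%:R) by lra.
  split => //; rewrite -(ler_nat R) -subr_ge0 e mulr_ge0 ?(ltW b0) //.
  by rewrite subr_ge0 ler_nat ltnW.
pose w p := (gaps p + matches omega p)%N.
have := @disjoint_intervals R s' (fun b => w (f b).1) (fun b => w (f b).2)
  (m - D) (m + D) srt.
move=> /(_ _ _)/wrap[||sumw].
- move=> b; rewrite s's => bs; have [b0 M1 M2 lt] := sP _ bs.
  have [_ le] := rise _ bs.
  have /andP[l1 u1] := maximiser_bounds pp0 g0 m0 nm (ltW b0) M1.
  have /andP[l2 u2] := maximiser_bounds pp0 g0 m0 nm (ltW b0) M2.
  by rewrite /w; split; lia.
- move=> b b'; rewrite !s's => bs b's bb'.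
  have [b0 M1 _ _] := sP _ bs; have [_ _ M2 _] := sP _ b's.
  have b0b' : 0 <= b < b' by rewrite ltW.
  have [] := maximisers_antitone b0b' M1 M2.
  by rewrite /w; lia.
pose t := T `^ 3^-1.
have t1 : 1 <= t by rewrite -(powRr0 T) ler_powR // invr_ge0.
(* The cube root of [T] balances [K ^ 2] and [2 T / K]. *)
pose K := (Num.truncn t).+1.
have := @few_slopes R s' (fun b => gaps (f b).2 - gaps (f b).1)%N
  (fun b => matches omega (f b).2 - matches omega (f b).1)%N K (D.*2) us'.
move=> /(_ _ _)/wrap[||].
- move=> b; rewrite s's => bs; have [b0 _ _ lt] := sP _ bs.
  have [e le] := rise _ bs.
  by split => //; [rewrite subn_gt0|rewrite !natrB // ltnW].
- apply: leq_trans (leq_trans sumw _); last by lia.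
  rewrite big_seq [X in (_ <= X)%N]big_seq; apply: leq_sum => b.
  rewrite s's => bs; have [_ _ _ lt] := sP _ bs; have [_ le] := rise _ bs.
  by rewrite /w; lia.
rewrite -(ler_nat R) natrM natrD natrX -muln2 natrM => main.
have tK : t <= K%:R by apply/ltW/truncnS_gt.
have Kt : K%:R <= 2 * t.
  rewrite /K -natr1; have : (Num.truncn t)%:R <= t by rewrite Num.Theory.truncn_le; lra.
  by lra.
have T3 : T = t ^+ 3 by rewrite -powR_mulrn ?powR_ge0 // -powRrM mulVf // powRr1; lra.
have -> : T `^ (2 / 3) = t ^+ 2 by rewrite -powR_mulrn ?powR_ge0 // -powRrM; congr (_ `^ _); lra.
have K0 : 0 < K%:R :> R by rewrite ltr0n.
rewrite -(ler_pM2r K0); apply: le_trans main _.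
have : K%:R ^+ 2 <= 4 * t ^+ 2 by nra.
rewrite (exprS _ 2); move: T3; rewrite exprS => T3.
have : t * t ^+ 2 <= K%:R * t ^+ 2 by rewrite ler_wpM2r // sqr_ge0.
by nra.
Qed.

(** * Deviations of the greedy alignment over all words *)

Lemma expR_quadratic (R : realType) (u : R) :
  u <= 2^-1 -> expR u <= 1 + u + 2 * u ^+ 2.
Proof.
move=> u2; have e0 := expR_gt0 u.
have : expR u * (1 - u) <= 1.
  rewrite -[leRHS](expRxMexpNx_1 u) ler_pM2l //; exact: expR_ge1Dx.
have : 0 <= u ^+ 2 * (1 - 2 * u) by rewrite mulr_ge0 ?sqr_ge0; lra.
move=> h1 h2; have u1 : 0 < 1 - u by lra.
rewrite -(ler_pM2r u1); apply: le_trans h2 _.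
by rewrite !expr2 in h1 *; nra.
Qed.

(** The left-hand side is the moment generating function of [p - B] for a
    Bernoulli variable [B] of parameter [p].  The linear terms cancel because
    this variable is centred. *)
Lemma centred_bernoulli (R : realType) (p t : R) :
  0 <= p <= 1 -> 0 <= t <= 2^-1 ->
  p * expR (t * (p - 1)) + (1 - p) * expR (t * p) <= expR (2 * t ^+ 2).
Proof.
move=> /andP[p0 p1] /andP[t0 t2].
have h1 : expR (t * (p - 1)) <= 1 + t * (p - 1) + 2 * (t * (p - 1)) ^+ 2.
  by apply: expR_quadratic; nra.
have h2 : expR (t * p) <= 1 + t * p + 2 * (t * p) ^+ 2.
  by apply: expR_quadratic; nra.
apply: le_trans (expR_ge1Dx _).
apply: (@le_trans _ _ (1 + 2 * t ^+ 2 * (p * (1 - p)))).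
  have := ler_wpM2l p0 h1.
  have p1' : 0 <= 1 - p by lra.
  by have := ler_wpM2l p1' h2; rewrite !expr2; nra.
have : 0 <= t ^+ 2 by apply: sqr_ge0.
have : p * (1 - p) <= 1 by nra.
have : 0 <= p * (1 - p) by nra.
by move: (t ^+ 2) => q; nra.
Qed.

(** The words of length [N], as a list: sums over words can then be unfolded one
    letter at a time. *)
Fixpoint words (A : finType) (N : nat) : seq (seq A) :=
  if N is N'.+1 then [seq a :: u | a <- enum A, u <- words A N'] else [:: [::]].

Lemma mem_words (A : finType) (u : seq A) : u \in words A (size u).
Proof.
elim: u => //= a u IH.
by apply: (allpairs_f (fun a u => a :: u)); rewrite ?mem_enum.
Qed.

Lemma sum_words_le (R : realType) (A : finType) (N : nat) (f : seq A -> bool) :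
  \sum_(u <- words A N) (f u)%:R <= #|A|%:R ^+ N :> R.
Proof.
elim: N f => [|N IH] f; first by rewrite /= big_seq1 expr0; case: (f _).
rewrite big_allpairs_dep /= big_enum /=.
by rewrite exprS mulr_natl -sumr_const; apply: ler_sum => a _; exact: IH.
Qed.

(** Whether the walk [i p - (greedy matches)] reaches the level [lam] while [u] is
    being read, when it starts from [s] and [j] letters of [y] are already
    matched. *)
Fixpoint deviates (R : realType) (A : eqType) (p lam : R) (y : nat -> A)
    (j : nat) (s : R) (u : seq A) : bool :=
  (lam <= s) ||
  (if u is a :: u' then
     deviates p lam y (j + (a == y j)) (s + p - (a == y j)%:R) u'
   else false).

Lemma deviates_greedy (R : realType) (A : eqType) (p lam : R)
    (x y : nat -> A) (N i k : nat) :
  ~~ deviates p lam y (greedy x y i) (i%:R * p - (greedy x y i)%:R)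
     [seq x l | l <- iota i N] ->
  (i <= k <= i + N)%N -> k%:R * p - (greedy x y k)%:R < lam.
Proof.
elim: N i => [|N IH] i /=.
  rewrite orbF -ltNge addn0 => lt ik.
  by have -> : k = i by lia.
rewrite negb_or -ltNge => /andP[lt nd] /andP[].
rewrite leq_eqVlt => /predU1P[<- //|ik kN].
apply: (IH i.+1); last by lia.
rewrite (_ : _ - _ = i%:R * p - (greedy x y i)%:R + p
  - (x i == y (greedy x y i))%:R) //.
by rewrite /= natrD -natr1; ring.
Qed.

Lemma eq_deviates (R : realType) (A : eqType) (p lam : R) (y y' : nat -> A)
    (j : nat) (s : R) (u : seq A) :
  (forall l, (l < j + size u)%N -> y l = y' l) ->
  deviates p lam y j s u = deviates p lam y' j s u.
Proof.
elim: u j s => [|a u IH] j s //= yy'.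
have -> : y j = y' j by apply: yy'; lia.
by rewrite IH // => l lj; apply: yy'; case: (a == _) lj; lia.
Qed.

(** Induction on the number of letters, the short word [y] being fixed.  If [s >= lam] the bound exceeds
    the number of all words.  Otherwise nothing happens at time zero and the
    first letter moves the walk by [p] or [p - 1]: exactly one letter of the
    alphabet equals [y j], so the bounds for the remaining letters average to
    the moment generating function of one step. *)
Lemma maximal_inequality (R : realType) (A : finType) (y : nat -> A) (t lam : R)
    (N j : nat) (s : R) :
  (0 < #|A|)%N -> 0 <= t <= 2^-1 ->
  \sum_(u <- words A N) (deviates #|A|%:R^-1 lam y j s u)%:R <=
    #|A|%:R ^+ N * expR (t * (s - lam) + 2 * t ^+ 2 * N%:R) :> R.
Proof.
move=> A0 t02; have k0 : 0 < #|A|%:R :> R by rewrite ltr0n.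
have t0 : 0 <= t by case/andP: t02.
elim: N j s => [|N IH] j s.
  rewrite /= big_seq1 expr0 mul1r mulr0 addr0 /= orbF.
  case: (leP lam s) => [ls|_]; last by rewrite mulr0n expR_ge0.
  by rewrite mulr1n -[leLHS]expR0 ler_expR mulr_ge0 // subr_ge0.
have [ls|ls] := leP lam s.
  apply: le_trans (@sum_words_le R A N.+1 _) _.
  rewrite ler_peMr ?exprn_ge0 ?(ltW k0) // -[leLHS]expR0 ler_expR addr_ge0 //.
    by rewrite mulr_ge0 // subr_ge0.
  by rewrite mulr_ge0 // mulr_ge0 // sqr_ge0.
rewrite big_allpairs_dep /= big_enum /=.
under eq_bigr do under eq_bigr do rewrite leNgt ls /=.
set p := _^-1; set E := expR _.
have step (a : A) :
    \sum_(u <- words A N) (deviates p lam y (j + (a == y j))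
      (s + p - (a == y j)%:R) u)%:R <=
    #|A|%:R ^+ N * expR (t * (s - lam) + 2 * t ^+ 2 * N%:R) *
    expR (t * (p - (a == y j)%:R)).
  apply: le_trans (IH _ _) _; rewrite -[leRHS]mulrA -expRD.
  by rewrite ler_pM2l ?exprn_gt0 // ler_expR; lra.
apply: (@le_trans _ _ (\sum_(a : A) (#|A|%:R ^+ N *
    expR (t * (s - lam) + 2 * t ^+ 2 * N%:R) * expR (t * (p - (a == y j)%:R))))).
  by apply: ler_sum => a _; exact: step.
rewrite -mulr_sumr (bigD1 (y j)) //= eqxx.
rewrite (eq_bigr (fun=> expR (t * p))); last first.
  by move=> a /negbTE ->; rewrite subr0.
rewrite sumr_const cardC1.
have pk : p * #|A|%:R = 1 by rewrite mulVf ?gt_eqF.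
have cb : expR (t * (p - 1)) + expR (t * p) *+ #|A|.-1 <=
    #|A|%:R * expR (2 * t ^+ 2).
  have p01 : 0 <= p <= 1.
    by rewrite invr_ge0 ltW //= invf_le1 // ler1n.
  have := centred_bernoulli p01 t02.
  rewrite -(ler_pM2l k0); apply: le_trans.
  have -> e : e *+ #|A|.-1 = e * (#|A|%:R - 1) :> R.
    by rewrite -[LHS]mulr_natr -subn1 natrB.
  move: pk; move: (expR _) (expR _) (#|A|%:R) => e2 e1 k pk.
  have -> : k * (p * e1 + (1 - p) * e2) = (p * k) * e1 + (k - p * k) * e2 by ring.
  by rewrite pk; lra.
apply: le_trans (ler_wpM2l _ cb) _; first by rewrite mulr_ge0 ?exprn_ge0 ?expR_ge0 // ltW.
have -> : E = expR (t * (s - lam) + 2 * t ^+ 2 * N%:R) * expR (2 * t ^+ 2).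
  by rewrite /E -expRD -(natr1 N) [_ * (_ + 1)]mulrDr mulr1 addrA.
by rewrite [_ ^+ N.+1]exprS le_eqVlt; apply/orP; left; apply/eqP; ring.
Qed.

(** * Random words *)

Lemma union_bound (R : realType) (d : measure_display) (Omega : measurableType d)
    (P : probability Omega R) (T : eqType) (r : seq T) (F : T -> set Omega)
    (c : T -> R) :
  (forall i, i \in r -> measurable (F i) /\ (P (F i) <= (c i)%:E)%E) ->
  measurable (\big[setU/set0]_(i <- r) F i) /\
  (P (\big[setU/set0]_(i <- r) F i) <= (\sum_(i <- r) c i)%:E)%E.
Proof.
elim: r => [|i r IH] Fc.
  by rewrite !big_nil measure0; split; [exact: measurable0|].
have [mF PF] := Fc i (mem_head _ _).
have [j jr|mU PU] := IH; first by apply: Fc; rewrite inE jr orbT.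
rewrite !big_cons; split; first exact: measurableU.
apply: le_trans (measureU2 _ mF mU) _.
by rewrite EFinD leeD.
Qed.

Lemma cylinder_probability (R : realType) (d : measure_display)
    (Omega : measurableType d) (P : probability Omega R) (A : finType)
    (etax etay : nat -> Omega -> A) (N : nat) (u v : seq A) :
  (0 < #|A|)%N -> iid_uniform_words P etax etay -> size u = N -> size v = N ->
  let C := [set w | [seq etax i w | i <- iota 0 N] = u /\
                    [seq etay i w | i <- iota 0 N] = v] in
  measurable C /\ P C = ((#|A|%:R^-1) ^+ (N + N))%:E.
Proof.
move=> /card_gt0P[a0 _] [[mX ind] unif] su sv C.
pose J : {fset nat + nat} := [fset k in
  [seq inl i | i <- iota 0 N] ++ [seq inr i | i <- iota 0 N]]%fset.
have kJ k : (k \in J) = (k \in [seq inl i | i <- iota 0 N]) ||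
                        (k \in [seq inr i | i <- iota 0 N]).
  by rewrite /J in_fset -mem_cat.
pose B (k : nat + nat) : set A :=
  match k with inl i => [set nth a0 u i] | inr i => [set nth a0 v i] end.
have mapE (e : nat -> Omega -> A) w (s : seq A) : size s = N ->
    [seq e i w | i <- iota 0 N] = s <->
    forall i, (i < N)%N -> e i w = nth a0 s i.
  move=> ss; split=> [<- i iN|H].
    by rewrite (nth_map 0%N) ?size_iota // nth_iota.
  apply: (@eq_from_nth _ a0); rewrite size_map size_iota // => i iN.
  by rewrite (nth_map 0%N) ?size_iota // nth_iota // H.
pose X (k : nat + nat) := match k with inl i => etax i | inr j => etay j end.
have CE : C = \bigcap_(k in [set` J]) (X k @^-1` B k).
  apply/seteqP; split => w.
    move=> [/(mapE _ _ _ su) xu /(mapE _ _ _ sv) yv] k /=.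
    rewrite kJ => /orP[] /mapP[i]; rewrite mem_iota /= add0n => iN ->.
      by rewrite /= xu.
    by rewrite /= yv.
  move=> H; split; apply/mapE => // i iN.
    apply: (H (inl i)); rewrite /= kJ map_f //.
    by rewrite mem_iota.
  apply: (H (inr i)); rewrite /= kJ map_f ?orbT //.
  by rewrite mem_iota.
split.
  by rewrite CE; apply: fin_bigcap_measurable => // k _; exact: mX.
rewrite CE ind (eq_bigr (fun=> (#|A|%:R^-1)%:E)); last first.
  by move=> [i|i] _; [exact: (unif (inl i))|exact: (unif (inr i))].
rewrite prodEFin; congr (_%:E); rewrite big_const_seq count_predT iter_mulr_1.
congr (_ ^+ _); rewrite [LHS]card_fseq undup_id.
  by rewrite size_cat !size_map size_iota.
rewrite cat_uniq !map_inj_uniq ?iota_uniq ?andbT /=; last 2 first.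
- by move=> ? ? [].
- by move=> ? ? [].
by apply/hasPn => k /mapP[i _ ->]; apply/mapP => -[].
Qed.

(** The event depends on the first [N] letters of each word only.  Cover it by
    the cylinders of the pairs of words that deviate; each of them has
    probability [k^(-2N)], and for each short word [maximal_inequality] counts
    the long ones.  The covering set is measurable by construction. *)
Lemma deviation_probability (R : realType) (d : measure_display)
    (Omega : measurableType d) (P : probability Omega R) (A : finType)
    (etax etay : nat -> Omega -> A) (N : nat) (t lam : R) :
  (0 < #|A|)%N -> iid_uniform_words P etax etay -> 0 <= t <= 2^-1 ->
  exists U : set Omega, [/\ measurable U,
    [set w | deviates #|A|%:R^-1 lam (fun j => etay j w) 0 0
               [seq etax i w | i <- iota 0 N]] `<=` U &
    (P U <= (expR (2 * t ^+ 2 * N%:R - t * lam))%:E)%E].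
Proof.
move=> A0 iid t02; have /card_gt0P[a0 _] := A0.
have k0 : 0 < #|A|%:R :> R by rewrite ltr0n.
pose C u v := [set w | [seq etax i w | i <- iota 0 N] = u /\
                       [seq etay i w | i <- iota 0 N] = v].
pose dev u v := deviates (#|A|%:R^-1 : R) lam (nth a0 v) 0 0 u.
pose q : R := (#|A|%:R^-1) ^+ (N + N).
have size_words M (u : seq A) : u \in words A M -> size u = M.
  elim: M u => [|M IH] u /=; first by rewrite inE => /eqP->.
  by move=> /allpairsP[[a v] [_ vM ->]] /=; rewrite IH.
pose F v := \big[setU/set0]_(u <- words A N) (if dev u v then C u v else set0).
have Fv v : v \in words A N -> measurable (F v) /\
    (P (F v) <= (\sum_(u <- words A N) (dev u v)%:R * q)%:E)%E.
  move=> /size_words vN; apply: union_bound => u /size_words uN.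
  case: ifP => _; last by rewrite measure0 mul0r; split; [exact: measurable0|].
  have [mC ->] := cylinder_probability A0 iid uN vN.
  by rewrite mul1r.
have [mU PU] := union_bound Fv.
exists (\big[setU/set0]_(v <- words A N) F v); split => //.
- move=> w /= bad.
  set u := [seq etax i w | i <- iota 0 N] in bad.
  pose v := [seq etay i w | i <- iota 0 N].
  have uN : size u = N by rewrite size_map size_iota.
  have vN : size v = N by rewrite size_map size_iota.
  have uw : u \in words A N by rewrite -uN mem_words.
  have vw : v \in words A N by rewrite -vN mem_words.
  rewrite -bigcup_seq; exists v => //=.
  rewrite /F -bigcup_seq; exists u => //=.
  rewrite (_ : dev u v) //; rewrite /dev.
  rewrite (@eq_deviates _ _ _ _ _ (fun j => etay j w)) // => l.
  rewrite add0n uN => lN.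
  by rewrite (nth_map 0%N) ?size_iota // nth_iota.
apply: le_trans PU _; rewrite lee_fin.
set e := expR _.
have inner v : \sum_(u <- words A N) (dev u v)%:R * q <= #|A|%:R ^+ N * e * q.
  rewrite -mulr_suml ler_wpM2r ?exprn_ge0 ?invr_ge0 ?(ltW k0) //.
  apply: le_trans (maximal_inequality (nth a0 v) lam N 0 0 A0 t02) _.
  rewrite ler_pM2l ?exprn_gt0 // ler_expR; lra.
apply: (@le_trans _ _ (\sum_(v <- words A N) true%:R * (#|A|%:R ^+ N * e * q))).
  by apply: ler_sum => v _; rewrite mul1r.
rewrite -mulr_suml.
apply: (@le_trans _ _ (#|A|%:R ^+ N * (#|A|%:R ^+ N * e * q))).
  rewrite ler_wpM2r ?mulr_ge0 ?exprn_ge0 ?invr_ge0 ?(ltW k0) ?expR_ge0 //.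
  exact: (@sum_words_le _ _ _ (fun=> true)).
have -> : #|A|%:R ^+ N * (#|A|%:R ^+ N * e * q) =
    #|A|%:R ^+ N * #|A|%:R ^+ N * q * e by ring.
have -> : #|A|%:R ^+ N * #|A|%:R ^+ N * q = 1.
  by rewrite -exprD -exprMn divff ?expr1n ?gt_eqF.
by rewrite mul1r /e ler_expR; lra.
Qed.

Lemma geometric_borel_cantelli (R : realType) (d : measure_display)
    (Omega : measurableType d) (P : probability Omega R)
    (U : nat -> set Omega) (r : R) :
  0 <= r < 1 -> (forall j, measurable (U j)) ->
  (forall j, (P (U j) <= (r ^+ j)%:E)%E) ->
  {ae P, forall w, exists j0, forall j, (j0 <= j)%N -> ~ U j w}.
Proof.
move=> /andP[r0 r1] mU PU.
have P0 : P (lim_sup_set U) = 0%E.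
  apply: lim_sup_set_cvg0 => //.
  apply: (@le_lt_trans _ _ ((1 - r)^-1)%:E); last exact: ltry.
  apply: lime_le; first by apply: is_cvg_nneseries => j _ _; exact: measure_ge0.
  apply: nearW => n.
  apply: (@le_trans _ _ (\sum_(0 <= j < n) (r ^+ j)%:E)%E).
    by apply: lee_sum => j _; exact: PU.
  rewrite sumEFin lee_fin big_mkord -[leRHS]mul1r ler_pdivlMr ?subr_gt0 //.
  have := subrX1 r n; have : 0 <= r ^+ n by rewrite exprn_ge0.
  by set S := \sum_(i < n) _; lra.
exists (lim_sup_set U); split => //.
  apply: bigcap_measurable => [|n _]; first by exists 0%N.
  by apply: bigcup_measurable => j _.
move=> w /= nw n _; apply: contrapT => no; apply: nw.
by exists n => j nj Ujw; apply: no; exists j.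
Qed.

Lemma ln2_ge (R : realType) : 2^-1 <= ln 2 :> R.
Proof.
rewrite -ler_expR lnK ?posrE //; apply: le_trans (expR_quadratic (lexx _)) _.
by rewrite expr2; lra.
Qed.

(** On the block of the times up to [2^(j+1)], the level
    [c * sqrt (2^j * j)] is reached with probability at most
    [exp (- c^2 j / 16)], by [deviation_probability] with
    [t = c / 8 * sqrt (j / 2^j)].  Each time [n] with [2^j <= n < 2^(j+1)] is
    covered by block [j], and there [j <= 2 ln n]. *)
Lemma greedy_lower (R : realType) (d : measure_display)
    (Omega : measurableType d) (P : probability Omega R) (A : finType)
    (etax etay : nat -> Omega -> A) (c : R) :
  (0 < #|A|)%N -> iid_uniform_words P etax etay -> 0 < c <= 4 ->
  {ae P, forall w, exists n0, forall n, (n0 <= n)%N ->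
     n%:R / #|A|%:R
       - (greedy (fun i => etax i w) (fun j => etay j w) n)%:R
     < c * Num.sqrt (2 * (n%:R * ln n%:R))}.
Proof.
move=> A0 iid /andP[c0 c4].
pose lam j : R := c * Num.sqrt (2 ^+ j * j%:R).
pose t j : R := c / 8 * Num.sqrt (j%:R / 2 ^+ j).
have p2 j : 0 < 2 ^+ j :> R by rewrite exprn_gt0.
have t02 j : 0 <= t j <= 2^-1.
  rewrite mulr_ge0 ?sqrtr_ge0 ?divr_ge0 ?(ltW c0) //=.
  have : Num.sqrt (j%:R / 2 ^+ j) <= 1 :> R.
    rewrite -[leRHS]sqrtr1 ler_wsqrtr // ler_pdivrMr // mul1r.
    by rewrite -natrX ler_nat ltnW // ltn_expl.
  have := sqrtr_ge0 (j%:R / 2 ^+ j : R).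
  by rewrite /t; nra.
have expo j : 2 * t j ^+ 2 * (2 ^ j.+1)%:R - t j * lam j = j%:R * - (c ^+ 2 / 16).
  have j0 : 0 <= j%:R / 2 ^+ j :> R by rewrite divr_ge0 // ltW.
  have -> : t j * lam j = c ^+ 2 / 8 * j%:R.
    rewrite /t /lam mulrACA -sqrtrM //.
    have -> : j%:R / 2 ^+ j * (2 ^+ j * j%:R) = j%:R ^+ 2 :> R.
      by field; rewrite gt_eqF.
    by rewrite sqrtr_sqr ger0_norm // expr2; ring.
  rewrite /t exprMn sqr_sqrtr // natrX [2 ^+ j.+1]exprS.
  by field; rewrite gt_eqF.
have /choice[U UP] j := deviation_probability (2 ^ j.+1) (lam j) A0 iid (t02 j).
have mU j : measurable (U j) by have [] := UP j.
have r01 : 0 <= expR (- (c ^+ 2 / 16)) < 1.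
  by rewrite expR_ge0 expR_lt1 oppr_lt0 divr_gt0 // exprn_gt0.
have PU j : (P (U j) <= (expR (- (c ^+ 2 / 16)) ^+ j)%:E)%E.
  by have [_ _] := UP j; rewrite expo expRM_natl.
have := geometric_borel_cantelli r01 mU PU.
apply: filterS => w [j0 H]; exists (2 ^ j0)%N => n nj0.
have n0 : (0 < n)%N by rewrite (leq_trans _ nj0) // expn_gt0.
pose j := trunc_log 2 n.
have /andP[jn nj] : (2 ^ j <= n < 2 ^ j.+1)%N by apply: trunc_log_bounds.
have jj0 : (j0 <= j)%N by rewrite trunc_log_max.
have nd : ~~ deviates #|A|%:R^-1 (lam j) (fun j => etay j w) 0 0
    [seq etax i w | i <- iota 0 (2 ^ j.+1)].
  by apply/negP => bad; apply: (H _ jj0); have [_ sub _] := UP j; apply: sub.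
have := @deviates_greedy R A #|A|%:R^-1 (lam j) (fun i => etax i w)
  (fun j => etay j w) (2 ^ j.+1) 0 n.
rewrite /= mul0r subr0 => /(_ nd); rewrite (ltnW nj) => /(_ isT) lt.
apply: lt_le_trans lt _; rewrite ler_pM2l //.
have n1 : 1 <= n%:R :> R by rewrite ler1n.
have jln : j%:R * 2^-1 <= ln n%:R :> R.
  apply: (@le_trans _ _ (ln (2 ^+ j))).
    by rewrite lnXn // -[leRHS]mulr_natl ler_wpM2l // ln2_ge.
  by rewrite ler_ln ?posrE // -?natrX ?ler_nat // ltr0n.
apply: ler_wsqrtr.
have : 2 ^+ j <= n%:R :> R by rewrite -natrX ler_nat.
have := ltW (p2 j); have := ler0n R j; move: (2 ^+ j) => q.
by move: jln; move: (ln _) => l; nra.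
Qed.

(** * Growth of the normalisation *)

Lemma powR_large (R : realType) (b C : R) : 0 < b ->
  \forall n \near \oo, C <= n%:R `^ b.
Proof.
move=> b0; near=> n; have Cn : `|C| `^ b^-1 <= n%:R by near: n; exact: nbhs_infty_ger.
apply: le_trans (ler_norm _) _.
have -> : `|C| = (`|C| `^ b^-1) `^ b by rewrite -powRrM mulVf ?gt_eqF // powRr1.
by apply: ge0_ler_powR; rewrite ?nnegrE ?powR_ge0 ?(ltW b0).
Unshelve. all: by end_near. Qed.

Lemma ln_le_powR (R : realType) (b : R) : 0 < b ->
  \forall n \near \oo, ln n%:R <= n%:R `^ b.
Proof.
move=> b0; have b2 : 0 < b / 2 by rewrite divr_gt0.
near=> n.
have n0 : 0 < n%:R :> R by near: n; exact: nbhs_infty_gtr.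
have big : (b / 2)^-1 <= n%:R `^ (b / 2) by near: n; exact: powR_large.
have : ln (n%:R `^ (b / 2)) <= n%:R `^ (b / 2).
  by apply/ltW/ln_sublinear/powR_gt0.
rewrite ln_powR -ler_pdivlMl // => /le_trans; apply.
have -> : n%:R `^ b = n%:R `^ (b / 2) * n%:R `^ (b / 2).
  by rewrite -powRD -?splitr // gt_eqF // implybT.
by rewrite ler_wpM2r ?powR_ge0.
Unshelve. all: by end_near. Qed.

Lemma sqrtr_le (R : realType) (u v : R) : 0 <= v -> u <= v ^+ 2 -> Num.sqrt u <= v.
Proof. by move=> v0 uv; rewrite -(ger0_norm v0) -sqrtr_sqr ler_wsqrtr. Qed.

(** What the proof uses of the normalisation: it dominates both sources of missing matches, [n^a] and
    the fluctuations of order [sqrt (n ln n)], and is negligible compared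
    with [n]. *)
Lemma g_fun_growth (R : realType) (a C : R) : 0 < a < 1 -> 0 <= C ->
  \forall n \near \oo, [/\ n%:R `^ a <= g_fun a n,
    Num.sqrt (n%:R * ln n%:R) <= g_fun a n, C <= g_fun a n &
    C * g_fun a n <= n%:R].
Proof.
move=> /andP[a0 a1] C0; rewrite /g_fun; case: leP => a2.
- have h0 : 0 < 2^-1 :> R by rewrite invr_gt0.
  near=> n.
  have n1 : 1 <= n%:R :> R by near: n; exact: nbhs_infty_ger.
  have ne : expR 1 <= n%:R :> R by near: n; exact: nbhs_infty_ger.
  have nC : C ^+ 2 <= n%:R `^ 2^-1 :> R by near: n; exact: powR_large.
  have nl : ln n%:R <= n%:R `^ 2^-1 :> R by near: n; exact: ln_le_powR.
  have ln1 : 1 <= ln n%:R :> R.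
    by rewrite -ler_expR lnK // posrE (lt_le_trans _ n1).
  have rr : n%:R `^ 2^-1 * n%:R `^ 2^-1 = n%:R :> R.
    by rewrite powR12_sqrt // -expr2 sqr_sqrtr.
  have rn : n%:R `^ 2^-1 <= n%:R :> R by apply: ler1_powR; lra.
  split => //.
  + apply: le_trans (ler_powR n1 a2) _; rewrite powR12_sqrt //.
    by apply: ler_wsqrtr; rewrite ler_peMr.
  + rewrite -(ger0_norm C0) -sqrtr_sqr ler_wsqrtr //.
    apply: le_trans nC _; apply: le_trans rn _; by rewrite ler_peMr.
  + rewrite -(ger0_norm C0) -sqrtr_sqr -sqrtrM ?sqr_ge0 //.
    apply: sqrtr_le => //; rewrite mulrCA expr2 ler_pM2l ?(lt_le_trans _ n1) //.
    rewrite -[leRHS]rr; apply: ler_pM => //; [exact: sqr_ge0|exact: le_trans ln1].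
- have a1' : 0 < 1 - a by lra.
  have a2' : 0 < 2 * a - 1 by lra.
  near=> n.
  have n1 : 1 <= n%:R :> R by near: n; exact: nbhs_infty_ger.
  have n0 : 0 < n%:R :> R by lra.
  have nn0 : n%:R != 0 :> R by rewrite gt_eqF.
  have nC : C <= n%:R `^ a :> R by near: n; exact: powR_large.
  have nC' : C <= n%:R `^ (1 - a) :> R by near: n; exact: powR_large.
  have nl : ln n%:R <= n%:R `^ (2 * a - 1) :> R by near: n; exact: ln_le_powR.
  split => //.
  + apply: sqrtr_le; first exact: powR_ge0.
    rewrite -powR_mulrn ?powR_ge0 // -powRrM.
    have -> : a * 2 = 1 + (2 * a - 1) by lra.
    by rewrite powRD ?nn0 ?implybT // powRr1 // ler_pM2l.
  + have nE : n%:R `^ (1 - a) * n%:R `^ a = n%:R :> R.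
      by rewrite -powRD ?nn0 ?implybT // subrK powRr1.
    by rewrite -[leRHS]nE ler_wpM2r ?powR_ge0.
Unshelve. all: by end_near. Qed.

Lemma limn_esup_le (R : realType) (u : nat -> \bar R) (l : \bar R) :
  (\forall n \near \oo, (u n <= l)%E) -> (limn_esup u <= l)%E.
Proof.
move=> ul; rewrite /limn_esup /limf_esup.
apply: (@le_trans _ _ (ereal_sup (u @` [set n | (u n <= l)%E]))).
  by apply: ereal_inf_lbound; exists [set n | (u n <= l)%E].
by apply: ge_ereal_sup => _ [n /= un <-].
Qed.

(** * The number of critical penalties *)

(** With [T = 4 x g(n) / k] and [D = floor T], the greedy alignment of the first
    [m - D] letters misses about [(3/2) x g(n) / k + D / k] letters out of [n]:
    [x g(n) / k] from the length of the long word and half as much from the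
    fluctuations.  Since [k >= 2], this is less than [D]. *)
Lemma eventually_few_critical (R : realType) (A : finType) (wx wy : nat -> A)
    (x a : R) :
  (2 <= #|A|)%N -> 0 < x -> 0 < a < 1 ->
  (exists n0, forall n, (n0 <= n)%N ->
     n%:R / #|A|%:R - (greedy wx wy n)%:R
     < x / (4 * #|A|%:R ^+ 2) * Num.sqrt (2 * (n%:R * ln n%:R))) ->
  \forall n \near \oo,
    (num_critical_penalties R (environment wx wy) (first_length x a #|A| n) n
     <= (6 * (4 * x / #|A|%:R * g_fun a n) `^ (2 / 3))%:E)%E.
Proof.
move=> A2 x0 a01 [n0 dev].
set k : R := #|A|%:R.
have k2 : 2 <= k by rewrite ler_nat.
have k0 : 0 < k by lra.
(* [C * g(n) <= n] and [C <= g(n)] give all the room needed: [3 x g(n) + 1 <= n]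
   leaves at least [n] letters in [m - D], and [g(n) >= 2 k / x] absorbs the
   rounding of [m] and [D]. *)
pose C := 3 * x + 1 + 2 * k / x.
have C0 : 0 <= C by rewrite addr_ge0 ?divr_ge0 //; lra.
near=> n.
have [Xg Sg Cg gn] : [/\ n%:R `^ a <= g_fun a n,
    Num.sqrt (n%:R * ln n%:R) <= g_fun a n, C <= g_fun a n &
    C * g_fun a n <= n%:R] by near: n; exact: g_fun_growth.
have nn0 : (n0 <= n)%N by near: n; exact: nbhs_infty_ge.
have nk : (#|A| <= n)%N by near: n; exact: nbhs_infty_ge.
move: (g_fun a n) Xg Sg Cg gn => G Xg Sg Cg gn.
have n2 : 2 <= n%:R :> R by rewrite ler_nat (leq_trans A2).
have kx0 : 0 < 2 * k / x by rewrite divr_gt0 // mulr_gt0.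
have G1 : 1 <= G by rewrite /C in Cg; lra.
have Gk : 2 * k / x <= G by rewrite /C in Cg; lra.
have xGk : 2 * k <= x * G by move: Gk; rewrite ler_pdivrMr // [G * x]mulrC.
have gn3 : 3 * (x * G) + 1 <= n%:R.
  have : 0 <= 2 * k / x * G by rewrite mulr_ge0 ?ltW //; lra.
  by move: gn; rewrite /C !mulrDl mul1r; move: (2 * k / x * G) => q; lra.
have X0 : 0 <= x * n%:R `^ a by rewrite mulr_ge0 ?powR_ge0 ?(ltW x0).
have XG : x * n%:R `^ a <= x * G by rewrite ler_pM2l.
pose T := 4 * x / k * G.
have TE : k * T = 4 * (x * G) by rewrite /T; field; rewrite gt_eqF.
have T8 : 8 <= T by rewrite -(ler_pM2l k0) TE; lra.
have T2 : T <= 2 * (x * G).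
  have h : 0 <= (k - 2) * (x * G) by rewrite mulr_ge0; lra.
  by rewrite -(ler_pM2l k0) TE; lra.
pose D := Num.truncn T.
have DT : D%:R <= T by rewrite Num.Theory.truncn_le; lra.
have TD : T < D%:R + 1 by rewrite natr1; exact: truncnS_gt.
set m := first_length x a #|A| n.
have kn : 2 * n%:R <= k * n%:R by rewrite ler_pM2r //; lra.
have mle : m%:R <= k * n%:R - x * n%:R `^ a.
  by rewrite /m /first_length Num.Theory.truncn_le; lra.
have mgt : k * n%:R - x * n%:R `^ a < m%:R + 1.
  by rewrite natr1; exact: truncnS_gt.
have nmD : n%:R + D%:R <= m%:R :> R by lra.
have {}nmD : (n + D <= m)%N by move: nmD; rewrite -natrD ler_nat.
have Dn : (D <= n)%N by rewrite -(ler_nat R); lra.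
have nm : (n <= m)%N := leq_trans (leq_addr D n) nmD.
have Dm : (D <= m)%N := leq_trans (leq_addl n D) nmD.
have nN : (n <= m - D)%N by rewrite leq_subRL // addnC.
have dv := dev (m - D)%N (leq_trans nn0 nN).
pose N := (m - D)%N; rewrite -/N -/k in dv.
have NE : N%:R = m%:R - D%:R :> R by rewrite natrB.
have sq : Num.sqrt (2 * (N%:R * ln N%:R)) <= 2 * k * G.
  have N1 : 1 <= N%:R :> R by rewrite (le_trans _ (_ : n%:R <= _)) ?ler_nat //; lra.
  have Nkn : N%:R <= k * n%:R by have := ler0n R D; lra.
  have lnN : ln N%:R <= 2 * ln n%:R :> R.
    have -> : 2 * ln n%:R = ln (n%:R ^+ 2) :> R.
      by rewrite lnXn ?mulr2n; lra.
    rewrite ler_ln ?posrE ?exprn_gt0 //; try lra.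
    by apply: le_trans Nkn _; rewrite expr2 ler_pM2r ?ler_nat //; lra.
  have ln0 : 0 <= ln n%:R :> R by apply: ln_ge0; lra.
  have lnN0 : 0 <= ln N%:R :> R by apply: ln_ge0.
  apply: (@le_trans _ _ (2 * k * Num.sqrt (n%:R * ln n%:R))); last first.
    by rewrite ler_pM2l // mulr_gt0.
  rewrite -[2 * k]ger0_norm ?mulr_ge0 ?(ltW k0) // -sqrtr_sqr -sqrtrM ?sqr_ge0 //.
  apply: ler_wsqrtr.
  have : N%:R * ln N%:R <= (k * n%:R) * (2 * ln n%:R) by apply: ler_pM => //; lra.
  have : 0 <= n%:R * ln n%:R :> R by rewrite mulr_ge0.
  move=> nl0; have : 0 <= k * (k - 1) * (n%:R * ln n%:R).
    by rewrite !mulr_ge0 ?(ltW k0) //; lra.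
  by rewrite exprMn !expr2; lra.
have kdv : k * (greedy wx wy N)%:R >= N%:R - x * G / 2.
  have h : x / (4 * k ^+ 2) * Num.sqrt (2 * (N%:R * ln N%:R)) <=
      x * G / 2 / k.
    apply: le_trans (ler_wpM2l _ sq) _.
      by rewrite divr_ge0 ?(ltW x0) // mulr_ge0 // sqr_ge0.
    rewrite le_eqVlt; apply/orP; left; apply/eqP; field; by rewrite gt_eqF.
  have h2 := lt_le_trans dv h.
  have : k * (N%:R / k - (greedy wx wy N)%:R) <= k * (x * G / 2 / k).
    by rewrite ler_pM2l // ltW.
  by rewrite mulrBr !(mulrCA k) !divff ?gt_eqF // !mulr1; lra.
have many : (n - D <= greedy wx wy N)%N.
  rewrite leq_subLR -(ler_nat R) natrD -(ler_pM2l k0) mulrDr.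
  have : 0 <= (k - 1) * (D%:R + 1 - T) by rewrite mulr_ge0; lra.
  by lra.
have [p [pp gp mp]] := greedy_path Dn Dm many.
apply: (critical_count pp gp mp); [exact: nm|by rewrite (le_trans _ T8) // ler1n|exact: DT].
Unshelve. all: by end_near. Qed.

Lemma constant_cvg0 (R : realType) (x : R) : 0 < x ->
  (6 * (4 * x / k%:R) `^ (2 / 3)) @[k --> \oo] --> (0 : R).
Proof.
move=> x0; apply/cvgr0Pnorm_le => e e0; near=> k.
have k1 : 1 <= k%:R :> R by near: k; exact: nbhs_infty_ger.
have kb : 4 * x / (e / 6) `^ (3 / 2) <= k%:R by near: k; exact: nbhs_infty_ger.
have e6 : 0 < e / 6 by rewrite divr_gt0.
have pe : 0 < (e / 6) `^ (3 / 2) by exact: powR_gt0.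
have k0 : 0 < k%:R :> R by lra.
rewrite ger0_norm ?mulr_ge0 ?powR_ge0 // mulrC -ler_pdivlMr //.
have -> : e / 6 = ((e / 6) `^ (3 / 2)) `^ (2 / 3).
  by rewrite -powRrM (_ : 3 / 2 * (2 / 3) = 1) ?powRr1 ?(ltW e6) //; field.
apply: ge0_ler_powR; rewrite ?nnegrE ?divr_ge0 ?mulr_ge0 ?(ltW x0) ?(ltW pe) //.
by rewrite ler_pdivrMr // [leRHS]mulrC -ler_pdivrMr.
Unshelve. all: by end_near. Qed.

Theorem theorem2p7 (R : realType) (x : R) (hx : 0 < x) :
  exists C1 : nat -> R,
    (forall (A : finType) (hA : (2 <= #|A|)%N)
       (d : measure_display) (Omega : measurableType d)
       (P : probability Omega R) (etax etay : nat -> Omega -> A),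
       iid_uniform_words P etax etay ->
       forall a : R, 0 < a < 1 ->
       {ae P, forall w : Omega,
          (limn_esup (fun n : nat =>
             num_critical_penalties R
               (environment (fun i => etax i w) (fun j => etay j w))
               (first_length x a #|A| n) n
             * ((g_fun a n `^ (2 / 3))^-1)%:E)
           <= (C1 #|A|)%:E)%E})
    /\ C1 k @[k --> \oo] --> (0 : R).
Proof.
exists (fun k => 6 * (4 * x / k%:R) `^ (2 / 3)); split; last exact: constant_cvg0.
move=> A hA d Omega P etax etay iid a a01.
have A0 : (0 < #|A|)%N by lia.
have k0 : 0 < #|A|%:R :> R by rewrite ltr0n.
(* [greedy_lower] requires [c <= 4]; the other bound is the one that matters. *)
pose c := Num.min 4 (x / (4 * #|A|%:R ^+ 2)).
have c04 : 0 < c <= 4.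
  rewrite /c lt_min ge_min lexx orTb andbT ltr0n /=.
  by rewrite divr_gt0 // mulr_gt0 // exprn_gt0.
apply: filterS (greedy_lower A0 iid c04) => w [n0 H].
have few := @eventually_few_critical R A (fun i => etax i w)
  (fun j => etay j w) x a hA hx a01.
apply: limn_esup_le.
have {}few : \forall n \near \oo,
    (num_critical_penalties R (environment (fun i => etax i w)
      (fun j => etay j w)) (first_length x a #|A| n) n
     <= (6 * (4 * x / #|A|%:R * g_fun a n) `^ (2 / 3))%:E)%E.
  apply: few; exists n0 => n /H lt; apply: lt_le_trans lt _.
  by rewrite ler_wpM2r ?sqrtr_ge0 // ge_min lexx orbT.
near=> n.
have g1 : 1 <= g_fun a n.
  by near: n; apply: filterS (g_fun_growth a01 (@ler01 R)) => n [].
have fewn : (num_critical_penalties R (environment (fun i => etax i w)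
      (fun j => etay j w)) (first_length x a #|A| n) n
     <= (6 * (4 * x / #|A|%:R * g_fun a n) `^ (2 / 3))%:E)%E by near: n.
have gp : 0 < g_fun a n `^ (2 / 3) by apply: powR_gt0; lra.
apply: le_trans (lee_wpmul2r _ fewn) _.
  by rewrite lee_fin invr_ge0 ltW.
rewrite -EFinM lee_fin powRM; [|by rewrite divr_ge0 ?mulr_ge0 ?ltW|by lra].
by rewrite mulrA mulfK // gt_eqF.
Unshelve. all: by end_near. Qed.
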